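(* If $B$ is positive-semidefinite, then $\mathcal{B}$ equipped with the norm $\|u\|_{H^1}+\|u\|_B$ is a Banach space.
   Context: Let $G:\mathbb{R}\times\mathbb{R}\to[0,\infty)$ be measurable and symmetric, $G(x,y)=G(y,x)$, so that $d\mu(x,y)=G(x,y)\,dx\,dy$ is a measure on $\mathbb{R}\times\mathbb{R}$. Define $b[f,g]=\iint_{\mathbb{R}\times\mathbb{R}} f(x)g(y)\,d\mu(x,y)$ and $B[f]=b[f,f]$. $B$ is called positive-semidefinite if $b[f,f]\geq 0$ for all $f\in L^1(\mathbb{R})$ (for which the double integral is well-defined as an extended real number, i.e. the positive part or the negative part of the integrand has finite integral). $H^1$ is the space of functions $u:\mathbb{R}\to\mathbb{R}$ with $\|u\|_{H^1}^2=\|u'\|_2^2+\|u\|_2^2<\infty$. Define $\mathcal{B}=\{u\in H^1: B[u^2]<\infty\}$ and $\|u\|_B=B[u^2]^{1/4}$. *)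

(* Defs.v *)
From HB Require Import structures.
From mathcomp Require Import all_boot all_order all_algebra.
From mathcomp Require Import all_classical all_reals all_analysis.
Import Order.TTheory GRing.Theory Num.Theory.
Import numFieldNormedType.Exports.

Set Implicit Arguments.
Unset Strict Implicit.
Unset Printing Implicit Defensive.

Local Open Scope classical_set_scope.
Local Open Scope ring_scope.

Section Forms.
Context {R : realType}.
Implicit Types (G : R -> R -> R) (f g : R -> R).

Local Notation leb := (@lebesgue_measure R).
Local Notation leb2 := (leb \x leb)%E.

(* f(x) g(y) G(x, y): the integrand of b[f, g] against dx dy, since
   d mu(x, y) = G(x, y) dx dy. *)
Definition form_integrand G f g (z : R * R) : \bar R :=
  (f z.1 * g z.2 * G z.1 z.2)%:E.

Definition bform G f g : \bar R :=
  (\int[leb2]_z form_integrand G f g z)%E.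

(* The library integral is always defined, with +oo - +oo = -oo; this predicate
   singles out the case where the integral exists in the extended reals. *)
Definition bform_defined G f g : Prop :=
  ((\int[leb2]_z (form_integrand G f g)^\+ z < +oo) \/
   (\int[leb2]_z (form_integrand G f g)^\- z < +oo))%E.

Definition Bform G f : \bar R := bform G f f.

Definition pos_semidef G : Prop :=
  forall f, f \in Lfun leb 1%E -> bform_defined G f f -> (0 <= bform G f f)%E.

End Forms.

Section Sobolev.
Context {R : realType}.
Implicit Types (u v phi : R -> R).

Local Notation leb := (@lebesgue_measure R).

Definition test_function phi : Prop :=
  (forall (n : nat) (x : R), derivable (derive1n n phi) x 1) /\
  compact (closure [set x | phi x != 0]).

Definition is_weak_derivative u v : Prop :=
  forall phi, test_function phi ->
    \int[leb]_x (u x * derive1 phi x) = - \int[leb]_x (v x * phi x).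

Definition L2_weak_derivatives u : set (R -> R) :=
  [set v | v \in Lfun leb 2%:E /\ is_weak_derivative u v].

Definition H1 : set (R -> R) :=
  [set u | u \in Lfun leb 2%:E /\ L2_weak_derivatives u !=set0].

(* Weak derivatives in L^2 are unique up to a null set, so nothing below depends
   on the representative chosen here; the default value 0 is irrelevant on H1. *)
Definition weak_derivative u : R -> R := xget (cst 0) (L2_weak_derivatives u).

Definition L2norm u : R := fine ('N[leb]_2%:E[EFin \o u])%E.

Definition H1norm u : R :=
  Num.sqrt (L2norm (weak_derivative u) ^+ 2 + L2norm u ^+ 2).

End Sobolev.

Section EnergySpace.
Context {R : realType}.
Implicit Types (G : R -> R -> R) (u v : R -> R).

Local Notation leb := (@lebesgue_measure R).

Definition calB G : set (R -> R) :=
  [set u | H1 u /\ (Bform G (fun x => u x ^+ 2)%R < +oo)%E].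

Definition Bnorm G u : R := fine (Bform G (fun x => u x ^+ 2)) `^ (4^-1).

(* The set S of functions, taken modulo equality almost everywhere and equipped
   with the pointwise operations and with N as norm, is a Banach space: S is
   stable under linear combinations, and there is a Banach space V with a
   surjection cls from S onto V which is linear, identifies exactly the
   functions that are equal almost everywhere, and turns N into the norm. The
   values of cls outside S are irrelevant. *)
Definition banach_mod_ae (S : set (R -> R)) (N : (R -> R) -> R) : Prop :=
  [/\ S (fun=> 0),
      forall (a : R) u v, S u -> S v -> S (fun x => a * u x + v x) &
      exists (V : completeNormedModType R) (cls : (R -> R) -> V),
        [/\ forall (a : R) u v, S u -> S v ->
              cls (fun x => a * u x + v x) = a *: cls u + cls v,
            forall u v, S u -> S v ->
              (cls u = cls v <-> {ae leb, forall x, u x = v x}),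
            cls @` S = [set: V] &
            forall u, S u -> `|cls u| = N u]].

End EnergySpace.

(* Main.v *)
Require Import Defs.
From HB Require Import structures.
From mathcomp Require Import all_boot all_order all_algebra.
From mathcomp Require Import all_classical all_reals all_analysis.
From mathcomp Require Import measurable_realfun ring lra.
Import Order.TTheory GRing.Theory Num.Theory.
Import numFieldNormedType.Exports.

Set Implicit Arguments.
Unset Strict Implicit.
Unset Printing Implicit Defensive.

Local Open Scope classical_set_scope.
Local Open Scope ring_scope.

(** The space is complete because each of its three ingredients is lower
    semicontinuous under convergence almost everywhere, while completeness of
    L^2 supplies the limit.

    That the norm is a norm rests on the positivity of the form. For
    nonnegative integrable f and g of finite energy, the identity
      B[f + g] = B[f] / s + B[g] / (1 - s) - B[(1 - s) f - s g] / (s (1 - s))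
    and B >= 0 give B[f + g] <= B[f] / s + B[g] / (1 - s) for 0 < s < 1
    (energy_convex); the integrand of the subtracted term has an integrable
    positive part, so its energy is defined. Combined with the pointwise bound
    (u + v)^2 <= u^2 / s + v^2 / (1 - s) this yields
      B[(u + v)^2] <= B[u^2] / s^3 + B[v^2] / (1 - s)^3
    (energy_quartic), and optimising over s turns it into the triangle
    inequality for B[u^2]^(1/4) (root4_le_add, BnormD).

    The H^1 norm is computed from a chosen weak derivative, so its linearity
    needs uniqueness of weak derivatives almost everywhere. This follows from
    smooth functions increasing to the indicator of an interval, built from
    exp(-1/x), and from Lebesgue differentiation (test_zero_ae).

    For completeness, take a sequence whose n-th term is within 2^-n of all
    later ones. Both the functions and their weak derivatives converge in L^2
    with the same rate, and the functions also converge almost everywhere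
    (L2_complete); the L^2 limit of the derivatives is a weak derivative of
    the limit (weak_derivative_limit). Fatou's lemma for the product measure
    bounds the energy of the difference with the limit (Bform_lsc), which
    shows at once that the limit has finite energy and that the convergence
    holds in the norm (calB_complete). Finally, a complete seminormed space
    becomes a Banach space after dividing by the null vectors
    (seminorm_quot_banach). *)

(** * The Banach space attached to a complete seminorm *)

Section SeminormQuotient.
Context (R : realType) (W : lmodType R) (N : W -> R).
Hypothesis ND : forall x y, N (x + y) <= N x + N y.
Hypothesis NZ : forall a x, N (a *: x) = `|a| * N x.

Let N0 : N 0 = 0. Proof. by rewrite -(scale0r 0) NZ normr0 mul0r. Qed.

Let NN x : N (- x) = N x.
Proof. by rewrite -scaleN1r NZ normrN normr1 mul1r. Qed.

Let N_ge0 x : 0 <= N x.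
Proof. by have := ND x (- x); rewrite subrr N0 NN -mulr2n pmulrn_lge0. Qed.

Let NB x y : N (x - y) = N (y - x). Proof. by rewrite -NN opprB. Qed.

Definition seminorm_null : {pred W} := fun x => N x == 0.

Let seminorm_null_zmod : zmod_closed seminorm_null.
Proof.
split=> [|x y]; rewrite !unfold_in ?N0// => /eqP x0 /eqP y0.
by rewrite eq_le N_ge0 andbT (le_trans (ND _ _))// NN x0 y0 addr0.
Qed.

HB.instance Definition _ :=
  GRing.isZmodClosed.Build W seminorm_null seminorm_null_zmod.

Definition seminorm_quot : Type := Quotient.quot seminorm_null.
HB.instance Definition _ := GRing.Zmodule.on seminorm_quot.
HB.instance Definition _ := EqQuotient.on seminorm_quot.

Local Open Scope quotient_scope.
Local Notation Q := seminorm_quot.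
Local Notation "[ x ]" := (\pi_Q x).

Let pi_eq x y : ([x] = [y]) <-> N (x - y) = 0.
Proof.
have e : (x == y %[mod Q]) = (N (x - y) == 0).
  by rewrite -[RHS]/(x - y \in seminorm_null) (Quotient.idealrBE seminorm_null).
by split=> [/eqP|/eqP xy]; [rewrite e => /eqP|apply/eqP; rewrite e].
Qed.

Let piD x y : [x + y] = [x] + [y].
Proof. exact: (Quotient.pi_add seminorm_null). Qed.

Let piN x : [- x] = - [x].
Proof. exact: (Quotient.pi_opp seminorm_null). Qed.

Let N_repr x : N (repr [x] - x) = 0.
Proof. by apply/pi_eq; rewrite reprK. Qed.

Definition quot_scale (a : R) (q : Q) : Q := [a *: repr q].

Let quot_scaleE a x : quot_scale a [x] = [a *: x].
Proof. by rewrite /quot_scale; apply/pi_eq; rewrite -scalerBr NZ N_repr mulr0. Qed.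

Let quot_scaleA a b q : quot_scale a (quot_scale b q) = quot_scale (a * b) q.
Proof. by rewrite -[q]reprK (quot_scaleE b) !quot_scaleE scalerA. Qed.

Let quot_scale1 : left_id 1 quot_scale.
Proof. by move=> q; rewrite -[q]reprK quot_scaleE scale1r. Qed.

Let quot_scaleDr : right_distributive quot_scale +%R.
Proof. by move=> a p q; rewrite -[p]reprK -[q]reprK -piD !quot_scaleE scalerDr piD. Qed.

Let quot_scaleDl q : {morph quot_scale^~ q : a b / a + b}.
Proof. by move=> a b; rewrite -[q]reprK !quot_scaleE scalerDl piD. Qed.

HB.instance Definition _ := GRing.Zmodule_isLmodule.Build R seminorm_quot
  quot_scaleA quot_scale1 quot_scaleDr quot_scaleDl.

Definition quot_norm (q : Q) : R := N (repr q).

Let quot_normE x : quot_norm [x] = N x.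
Proof.
apply/eqP; rewrite eq_le; apply/andP; split.
  by rewrite /quot_norm -[repr _](subrK x) (le_trans (ND _ _))// N_repr add0r.
rewrite -[leLHS]/(N x) -[x in leLHS](subrK (repr [x])) (le_trans (ND _ _))//.
by rewrite NB N_repr add0r.
Qed.

Let quot_normD p q : quot_norm (p + q) <= quot_norm p + quot_norm q.
Proof. by rewrite -[p]reprK -[q]reprK -piD !quot_normE. Qed.

Let quot_normZ a q : quot_norm (a *: q) = `|a| * quot_norm q.
Proof. by rewrite -[q]reprK [_ *: _]quot_scaleE !quot_normE. Qed.

Let quot_norm0 q : quot_norm q = 0 -> q = 0.
Proof.
rewrite -[q]reprK quot_normE => q0.
by rewrite -[0](subrr [0]) -piN -piD subrr; apply/pi_eq; rewrite subr0.
Qed.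

HB.instance Definition _ := Lmodule_isNormed.Build R seminorm_quot
  quot_normD quot_normZ quot_norm0.

(* Completeness is only asked of sequences with an explicit rate, which is what
   almost everywhere convergence in L^2 requires. *)
Hypothesis N_complete : forall u : nat -> W,
  (forall n m, (n <= m)%N -> N (u n - u m) <= 2^-1 ^+ n) ->
  exists l, N (u n - l) @[n --> \oo] --> 0.

(** A Cauchy filter contains a ball of radius 2^-n / 2 for each n; two members
    of the filter meet, so the centers of these balls form a sequence with the
    rate that N_complete asks for. *)
Let quot_complete (F : set_system seminorm_quot) :
  ProperFilter F -> cauchy F -> cvg F.
Proof.
move=> FF /cauchyP cF.
pose r n : R := 2^-1 ^+ n / 2.
have r0 n : 0 < r n by rewrite divr_gt0// exprn_gt0.
have /choice[q Fq] n : exists q : Q, F (ball q (r n)) by exact: cF.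
have qqle n m : (n <= m)%N -> `|q n - q m| <= 2^-1 ^+ n.
  move=> nm; have [x [xn xm]] := filter_ex (filterI (Fq n) (Fq m)).
  move: xn xm; rewrite -ball_normE /= => xn xm.
  rewrite -(subrKA x) (le_trans (ler_normD _ _))//.
  rewrite [leRHS](splitr (2^-1 ^+ n)) lerD ?(ltW xn)// distrC (le_trans (ltW xm))//.
  by rewrite ler_pM2r ?invr_gt0// ler_wiXn2l// invf_le1// ler1n.
have [|l ul] := @N_complete (fun n => repr (q n)).
  move=> n m nm; rewrite -quot_normE piD piN !reprK; exact: qqle.
apply/cvg_ex; exists [l]; apply/cvgrPdist_lt => e e0.
have ql : `|q n - [l]| @[n --> \oo] --> (0 : R).
  by move: ul; apply: cvg_trans; apply: near_eq_cvg; near=> n;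
     rewrite -[RHS]/(quot_norm _) -[q n]reprK -piN -piD quot_normE reprK.
have rc : r n @[n --> \oo] --> (0 : R).
  rewrite -(mul0r 2^-1); apply: cvgM; last exact: cvg_cst.
  by apply: cvg_expr; rewrite ger0_norm// invf_lt1// ltr1n.
have e20 : 0 < e / 2 by rewrite divr_gt0.
near \oo => n.
apply: filterS (Fq n) => x; rewrite -ball_normE /= => xn.
rewrite -(subrKA (q n)) (le_lt_trans (ler_normD _ _))// [ltRHS]splitr ltrD//.
  rewrite distrC; near: n.
  move/cvgrPdist_lt: ql => /(_ _ e20); apply: filterS => n.
  by rewrite sub0r normrN normr_id.
apply: (lt_trans xn); near: n.
move/cvgrPdist_lt: rc => /(_ _ e20); apply: filterS => n.
by rewrite sub0r normrN gtr0_norm.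
Unshelve. all: by end_near. Qed.

HB.instance Definition _ := Uniform_isComplete.Build seminorm_quot quot_complete.

Lemma seminorm_quot_banach : exists (V : completeNormedModType R) (cls : W -> V),
  [/\ forall a x y, cls (a *: x + y) = a *: cls x + cls y,
      forall x y, cls x = cls y <-> N (x - y) = 0,
      cls @` [set: W] = [set: V] &
      forall x, `|cls x| = N x].
Proof.
exists seminorm_quot, (fun x => [x]); split=> [a x y|x y||x].
- by rewrite piD -quot_scaleE.
- exact: pi_eq.
- by apply/seteqP; split=> // q _; exists (repr q); rewrite ?reprK.
- exact: quot_normE.
Qed.

End SeminormQuotient.
(** * Smooth functions approximating the indicator of an interval *)

Section Flat.
Context {R : realType}.
Implicit Types (x : R) (f g : R -> R).

(** x^-k exp(-1/x) for positive x, extended by 0. Keeping all exponents k makes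
    the family closed under derivation up to linear combinations. *)
Definition flat (k : nat) x : R :=
  if 0 < x then x^-1 ^+ k * expR (- x^-1) else 0.

Lemma flat_ge0 k x : 0 <= flat k x.
Proof.
by rewrite /flat; case: ifPn => // x0; rewrite mulr_ge0 ?expR_ge0// exprn_ge0// invr_ge0 ltW.
Qed.

Lemma flat_eq0 k x : x <= 0 -> flat k x = 0.
Proof. by rewrite /flat leNgt => /negbTE ->. Qed.

Lemma flat0_gt0 x : 0 < x -> 0 < flat 0 x.
Proof. by rewrite /flat => ->; rewrite expr0 mul1r expR_gt0. Qed.

(** One term of the exponential series, exp y >= y^(k+2) / (k+2)!, taken at
    y = 1/x. Quadratic decay is what makes the derivative at 0 vanish. *)
Lemma flat_le_sqr k x : flat k x <= (k.+2)`!%:R * x ^+ 2.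
Proof.
rewrite /flat; case: ifPn => [x0|_]; last by rewrite mulr_ge0// sqr_ge0.
have y0 : 0 < x^-1 by rewrite invr_gt0.
have f0 : 0 < (k.+2)`!%:R :> R by rewrite ltr0n fact_gt0.
have key : x^-1 ^+ k.+2 <= (k.+2)`!%:R * expR x^-1.
  rewrite mulrC -ler_pdivrMr// (le_trans _ (expR_ge1Dxn k.+1 (ltW y0)))//.
  by rewrite lerDr.
have -> : x^-1 ^+ k = x^-1 ^+ k.+2 * x ^+ 2.
  by rewrite -addn2 exprD -mulrA -exprMn mulVf ?gt_eqF// expr1n mulr1.
rewrite expRN ler_pdivrMr ?expR_gt0// [leRHS]mulrAC ler_pM2r//.
by rewrite exprn_gt0.
Qed.

Lemma is_derive_flat k x :
  is_derive x 1 (flat k) (flat k.+2 x - k%:R * flat k.+1 x).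
Proof.
have [x0|x0|->] := ltgtP x 0.
- rewrite !flat_eq0 ?(ltW x0)// mulr0 subr0.
  apply: (near_eq_is_derive (f := cst 0)).
  by near=> y; rewrite flat_eq0// ltW//; near: y; exact: lt_nbhsl.
- have d : is_derive x 1 (fun y : R => y^-1) (- x ^- 2 *: 1).
    by apply: is_deriveV; rewrite gt_eqF.
  have d1 := is_deriveX k d.
  have d2 := is_derive1_comp (f := expR) (g := - (fun y : R => y^-1))
    (is_derive_expR _) (is_deriveN d).
  have := is_deriveM d1 d2; rewrite /= => {}d.
  apply: (near_eq_is_derive (f := (((fun y => y^-1) ^+ k) * (expR \o - (fun y : R => y^-1))))).
    near=> y; rewrite /flat; have -> : 0 < y by near: y; exact: lt_nbhsr.
    by rewrite /GRing.mul/= exprfctE.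
  apply: (is_derive_eq d).
  rewrite /flat x0 exprfctE !scaler1 /GRing.scale/= opprfctE.
  case: k d d1 => [|k] d d1; first by rewrite !mul0r expr0 expr2 invfM; ring.
  by rewrite /= !exprS expr0 !invfM invr1; ring.
- rewrite !flat_eq0// mulr0 subr0.
  have lim0 : h^-1 *: (flat k (h + 0) - flat k 0) @[h --> (0:R)^'] --> (0 : R).
    pose C : R := (k.+2)`!%:R.
    have Ch : C * `|h| @[h --> (0:R)^'] --> (0 : R).
      rewrite -[X in _ --> X](mulr0 C); apply: cvgM; first exact: cvg_cst.
      apply: cvg_within_filter; have := @norm_continuous _ R (0 : R).
      by rewrite /continuous_at normr0.
    apply: norm_cvg0; apply: (squeeze_cvgr _ (cvg_cst 0) Ch).
    near=> h; rewrite normr_ge0/= addr0 (@flat_eq0 k 0)// subr0.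
    have h0 : h != 0 by near: h; exact: nbhs_dnbhs_neq.
    rewrite normrZ normfV ler_pdivrMl ?normr_gt0// (ger0_norm (flat_ge0 _ _)).
    by rewrite mulrCA -expr2 real_normK ?num_real// flat_le_sqr.
  apply: DeriveDef.
    apply/cvg_ex; exists 0; move: lim0; apply: cvg_trans; apply: near_eq_cvg.
    by near=> h; rewrite /= [h *: _]mulr1.
  rewrite /derive; apply: cvg_lim => //; move: lim0; apply: cvg_trans; apply: near_eq_cvg.
  by near=> h; rewrite /= [h *: _]mulr1.
Unshelve. all: by end_near. Qed.

(** A class of differentiable functions stable under derivation consists of
    smooth functions, so one derivative at a time suffices. The exponential
    constructor is there for the outer exponential of bump. *)
Inductive flat_alg : (R -> R) -> Prop :=
| flat_alg_cst (c : R) : flat_alg (cst c)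
| flat_alg_left (k : nat) (a : R) : flat_alg (fun x => flat k (x - a))
| flat_alg_right (k : nat) (b : R) : flat_alg (fun x => flat k (b - x))
| flat_algD f g : flat_alg f -> flat_alg g -> flat_alg (f + g)
| flat_algM f g : flat_alg f -> flat_alg g -> flat_alg (f * g)
| flat_alg_exp f : flat_alg f -> flat_alg (expR \o f).

Lemma flat_alg_derive f : flat_alg f ->
  exists2 g, flat_alg g & forall x : R, is_derive x 1 f (g x).
Proof.
elim=> {f} [c|k a|k b|f g _ [f' ff' df] _ [g' gg' dg]
  |f g Ff [f' ff' df] Fg [g' gg' dg]|f Ff [f' ff' df]].
- by exists (cst 0) => [|x]; [exact: flat_alg_cst|exact: is_derive_cst].
- exists ((fun x => flat k.+2 (x - a)) + cst (- k%:R) * (fun x => flat k.+1 (x - a))).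
    by repeat constructor.
  move=> x; have d : is_derive x 1 (id + cst (- a)) (1 + 0 : R).
    exact: is_deriveD.
  have e := is_derive1_comp (f := flat k) (g := id + cst (- a)) (is_derive_flat k _) d.
  apply: (is_derive_eq (f := flat k \o (id + cst (- a))) e).
  by rewrite addr0 mulr1 /GRing.add/GRing.mul/= mulNr.
- exists (cst (-1) * ((fun x => flat k.+2 (b - x)) +
    cst (- k%:R) * (fun x => flat k.+1 (b - x)))).
    by repeat constructor.
  move=> x; have d : is_derive x 1 (cst b - id) (0 - 1 : R).
    exact: is_deriveB.
  have e := is_derive1_comp (f := flat k) (g := cst b - id) (is_derive_flat k _) d.
  apply: (is_derive_eq (f := flat k \o (cst b - id)) e).
  by rewrite sub0r mulrC -(mulNr k%:R).
- by exists (f' + g') => [|x]; [exact: flat_algD|exact: is_deriveD].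
- exists (f * g' + g * f') => [|x]; last exact: is_deriveM.
  by apply: flat_algD; exact: flat_algM.
- exists ((expR \o f) * f') => [|x].
    by apply: flat_algM => //; exact: flat_alg_exp.
  exact: (is_derive1_comp (is_derive_expR _)).
Qed.

Lemma flat_alg_smooth f n x : flat_alg f -> derivable (derive1n n f) x 1.
Proof.
move=> Ff; suff /flat_alg_derive[g _ dg] : flat_alg (derive1n n f).
  by have [] := dg x.
elim: n => [|n /flat_alg_derive[g Fg dg]]; first by rewrite derive1n0.
rewrite derive1nS; suff -> : (derive1n n f)^`()%classic = g by [].
by apply/funext => y; rewrite derive1E; have [] := dg y.
Qed.

(** With p > 0 exactly on the interval, 1 - exp(-n p) is supported in its
    closure, stays between 0 and 1, and tends to the indicator as n grows. *)
Definition bump (a b : R) (n : nat) x : R :=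
  1 - expR (- n%:R * (flat 0 (x - a) * flat 0 (b - x))).

Lemma bump_ge0 a b n x : 0 <= bump a b n x.
Proof.
by rewrite subr_ge0 expR_le1 mulNr oppr_le0 !mulr_ge0// flat_ge0.
Qed.

Lemma bump_le1 a b n x : bump a b n x <= 1.
Proof. by rewrite lerBlDr lerDl expR_ge0. Qed.

Lemma bump_out a b n x : x \notin `]a, b[ -> bump a b n x = 0.
Proof.
rewrite in_itv/= negb_and -!leNgt /bump => /orP[xa|bx].
  by rewrite (@flat_eq0 _ (x - a)) ?subr_le0// mul0r mulr0 expR0 subrr.
by rewrite (@flat_eq0 _ (b - x)) ?subr_le0// !mulr0 expR0 subrr.
Qed.

Lemma bump_cvg a b x : x \in `]a, b[ -> bump a b n x @[n --> \oo] --> (1 : R).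
Proof.
rewrite in_itv/= => /andP[ax xb].
set p := flat 0 (x - a) * flat 0 (b - x).
have p0 : 0 < p by rewrite mulr_gt0// flat0_gt0// subr_gt0.
rewrite -[X in _ --> X](subr0 1) /bump; apply: cvgB; first exact: cvg_cst.
rewrite -/p.
have q1 : `|expR (- p)| < 1 by rewrite ger0_norm ?expR_ge0// expR_lt1 oppr_lt0.
have := cvg_expr q1; apply: cvg_trans; apply: near_eq_cvg; near=> n.
by rewrite -expRM_natl mulrN mulNr.
Unshelve. all: by end_near. Qed.

Lemma bump_test a b n : test_function (bump a b n).
Proof.
split.
  move=> m x; apply: flat_alg_smooth.
  have -> : bump a b n = cst 1 + cst (-1) *
     (expR \o (cst (- n%:R) * ((fun x => flat 0 (x - a)) * (fun x => flat 0 (b - x))))).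
    by apply/funext => y; rewrite /bump /GRing.add /GRing.mul/= mulN1r.
  by repeat constructor.
apply: (subclosed_compact _ (segment_compact (a := a) (b := b))).
  exact: closed_closure.
rewrite closureE => x; apply; split; first exact: itv_closed.
move=> y /=; apply: contraNP => yab; rewrite bump_out//.
by apply/negP => /subset_itv_oo_cc.
Qed.

End Flat.
(** * The space L^2 *)

(** Fatou's lemma in the form used throughout: a uniform bound on the integrals
    passes to an almost everywhere limit. *)
Lemma le_integral_ae_cvg d (T : measurableType d) (R : realType)
    (mu : {measure set T -> \bar R}) (f : nat -> T -> R) (g : T -> R) (c : \bar R) :
  (forall n, measurable_fun setT (f n)) -> measurable_fun setT g ->
  (forall n x, 0 <= f n x) -> {ae mu, forall x, f n x @[n --> \oo] --> g x} ->
  (forall n, \int[mu]_x (f n x)%:E <= c)%E -> (\int[mu]_x (g x)%:E <= c)%E.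
Proof.
move=> mf mg f0 fg fc.
have mfE n : measurable_fun setT (EFin \o f n) by exact/measurable_EFinP.
rewrite (ae_eq_integral (fun x => limn_einf (fun n => (f n x)%:E))) //.
- apply: (le_trans (fatou _ measurableT mfE _)); first by move=> n x _; rewrite lee_fin.
  rewrite limn_einf_lim; apply: lime_le; first exact: is_cvg_einfs.
  apply: nearW => n; apply: le_trans (fc n).
  by apply: ereal_inf_lbound; exists n => /=.
- exact/measurable_EFinP.
- rewrite (_ : (fun x => _) = (fun x => - limn_esup (fun n => - (f n x)%:E))%E).
    apply: measurableT_comp => //; apply: measurable_fun_limn_esup => n.
    by apply: measurableT_comp => //; exact: mfE.
  by apply/funext => x; rewrite (limn_esupN (fun n => (f n x)%:E)) oppeK.
- apply: filterS fg => x fx _; apply/esym.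
  have : (f n x)%:E @[n --> \oo] --> (g x)%:E by apply: cvg_EFin; first exact: nearW.
  by move=> /cvg_limn_einf_sup[-> _].
Qed.

Section L2.
Context {R : realType}.
Implicit Types (f g : R -> R).
Local Notation leb := (@lebesgue_measure R).
Local Notation L2 := (Lfun leb 2%:E).

#[global] Instance lebesgue_ae_filter : Filter (nbhs (almost_everywhere leb)) :=
  ae_filter_ringOfSetsType leb.

Lemma L2_measurable f : f \in L2 -> measurable_fun setT f.
Proof. by rewrite inE => /andP[/[!inE]]. Qed.

Lemma Lnorm2_sqr f : ('N[leb]_2%:E[EFin \o f] `^ 2 = \int[leb]_x (f x ^+ 2)%:E)%E.
Proof.
rewrite powR_Lnorm//; apply: eq_integral => x _ /=.
by rewrite powR_mulrn// real_normK ?num_real.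
Qed.

Lemma L2P f : f \in L2 <->
  measurable_fun setT f /\ (\int[leb]_x (f x ^+ 2)%:E < +oo)%E.
Proof.
split=> [/[dup] /L2_measurable mf|[mf foo]].
  rewrite inE => /andP[_ /[!inE]/=] ffin; split => //.
  by rewrite -Lnorm2_sqr; exact: poweR_lty.
rewrite inE; apply/andP; split; rewrite inE//= /finite_norm.
by apply: (@lty_poweRy _ _ 2); rewrite ?Lnorm2_sqr.
Qed.

Lemma L2norm_ge0 f : 0 <= L2norm f.
Proof. by rewrite fine_ge0// Lnorm_ge0. Qed.

Lemma EFin_L2norm f : f \in L2 -> ((L2norm f)%:E = 'N[leb]_2%:E[EFin \o f])%E.
Proof.
rewrite inE => /andP[_ /[!inE]/=] ffin; rewrite /L2norm fineK//.
by rewrite ge0_fin_numE// Lnorm_ge0.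
Qed.

Lemma L2norm_sqr f : f \in L2 -> ((L2norm f ^+ 2)%:E = \int[leb]_x (f x ^+ 2)%:E)%E.
Proof.
by move=> fL; rewrite -Lnorm2_sqr -EFin_L2norm// poweR_EFin powR_mulrn// L2norm_ge0.
Qed.

Lemma L2_lin (a : R) f g : f \in L2 -> g \in L2 -> (fun x => a * f x + g x) \in L2.
Proof.
have [_] := @Lfun_submod_closed _ _ R leb 2%:E (lee1n 2).
by move=> /[apply]; apply.
Qed.

Lemma L2B f g : f \in L2 -> g \in L2 -> f - g \in L2.
Proof.
move=> fL gL; rewrite (_ : f - g = (fun x => -1 * g x + f x)); first exact: L2_lin.
by apply/funext => x; rewrite mulN1r addrC.
Qed.

Lemma L2_0 : (fun _ : R => 0 : R) \in L2.
Proof. by have [] := @Lfun_submod_closed _ _ R leb 2%:E (lee1n 2). Qed.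

Lemma L2normD f g : f \in L2 -> g \in L2 -> L2norm (f + g) <= L2norm f + L2norm g.
Proof.
move=> fL gL; rewrite -lee_fin EFinD !EFin_L2norm//.
  by apply: (@eminkowski _ _ _ leb f g 2%:E);
    [exact: (L2_measurable fL)|exact: (L2_measurable gL)|rewrite lee1n].
rewrite (_ : f + g = (fun x => 1 * f x + g x)); first exact: L2_lin.
by apply/funext => x; rewrite mul1r.
Qed.

Lemma L2normZ (a : R) f : f \in L2 -> L2norm (fun x => a * f x) = `|a| * L2norm f.
Proof.
move=> fL; have gL : (fun x => a * f x) \in L2.
  rewrite (_ : (fun _ => _) = (fun x => a * f x + 0)); first exact: L2_lin L2_0.
  by apply/funext => x; rewrite addr0.
apply/eqP; rewrite -(@eqrXn2 _ 2)// ?mulr_ge0 ?L2norm_ge0//; apply/eqP/EFin_inj.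
rewrite L2norm_sqr// exprMn EFinM L2norm_sqr// -ge0_integralZl//.
- by apply: eq_integral => x _; rewrite -EFinM exprMn real_normK ?num_real.
- by apply/measurable_EFinP; apply: measurable_funX; exact: (L2_measurable fL).
- by move=> x _; rewrite lee_fin sqr_ge0.
Qed.

Lemma L2norm_ae f g : f \in L2 -> g \in L2 ->
  {ae leb, forall x, f x = g x} -> L2norm f = L2norm g.
Proof.
move=> fL gL fg.
apply/eqP; rewrite -(@eqrXn2 _ 2)// ?L2norm_ge0//; apply/eqP/EFin_inj.
rewrite !L2norm_sqr//; apply: ae_eq_integral => //.
- by apply/measurable_EFinP; apply: measurable_funX; exact: (L2_measurable fL).
- by apply/measurable_EFinP; apply: measurable_funX; exact: (L2_measurable gL).
- by apply: filterS fg => x -> _.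
Qed.

Lemma L2norm0_ae f : f \in L2 -> L2norm f = 0 -> {ae leb, forall x, f x = 0}.
Proof.
move=> fL f0; have := EFin_L2norm fL; rewrite f0 => /esym/Lnorm_eq0_eq0.
have mf : measurable_fun setT (EFin \o f) by apply/measurable_EFinP; exact: (L2_measurable fL).
move=> /(_ mf (lte0n _)); apply: filterS => x /(_ I) [].
by [].
Qed.

Lemma L2_mul_integrable f g : f \in L2 -> g \in L2 ->
  leb.-integrable setT (fun x => (f x * g x)%:E).
Proof. by move=> fL gL; apply/Lfun1_integrable; exact: Lfun2_mul_Lfun1. Qed.

Lemma Rintegral_mul_le f g : f \in L2 -> g \in L2 ->
  `|\int[leb]_x (f x * g x)| <= L2norm f * L2norm g.
Proof.
move=> fL gL; have := L2_mul_integrable fL gL => ifg.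
apply: (le_trans (le_normr_Rintegral _ ifg)) => //.
rewrite -lee_fin EFinM !EFin_L2norm// /Rintegral fineK; last first.
  by apply: integrable_fin_num => //; exact: integrable_abse ifg.
have := hoelder leb (L2_measurable fL) (L2_measurable gL) (ltr0n _ 2) (ltr0n _ 2).
rewrite Lnorm1; apply; lra.
Qed.

End L2.
(** * Completeness of L^2, with convergence almost everywhere *)

Section RieszFischer.
Context {R : realType}.
Local Notation leb := (@lebesgue_measure R).
Local Notation L2 := (Lfun leb 2%:E).

(** By t <= 1 + t^2 with t = 2^n |d|, each increment d satisfies
    |d| <= 2^-n + 2^n d^2, so the increments are absolutely summable. *)
Lemma cvg_of_increments (a : nat -> R) :
  (\sum_(0 <= n <oo) (2 ^+ n * (a n.+1 - a n) ^+ 2)%:E < +oo)%E -> cvgn a.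
Proof.
set w := fun n => 2 ^+ n * (a n.+1 - a n) ^+ 2 => woo.
have w0 n : 0 <= w n by rewrite mulr_ge0 ?sqr_ge0// exprn_ge0.
have cw : cvgn (series w).
  apply: nondecreasing_is_cvgn.
    by apply/nondecreasing_seqP => n; rewrite !seriesEnat/= big_nat_recr//= lerDl.
  exists (fine (\sum_(0 <= n <oo) (w n)%:E)%E) => _ [n _ <-].
  rewrite -lee_fin fineK ?ge0_fin_numE ?nneseries_ge0//; last first.
    by move=> k _ _; rewrite lee_fin.
  rewrite seriesEnat/= -sumEFin; apply: nneseries_lim_ge => k _ _.
  by rewrite lee_fin.
have cg : cvgn (series (fun n => 2^-1 ^+ n : R)).
  rewrite (_ : (fun _ => _) = geometric 1 2^-1).
    by apply: is_cvg_geometric_series; rewrite ger0_norm// invf_lt1// ltr1n.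
  by apply/funext => n; rewrite /= mul1r.
have le_inc n : `|a n.+1 - a n| <= 2^-1 ^+ n + w n.
  have p0 : (0 : R) < 2 ^+ n by rewrite exprn_gt0.
  rewrite -(ler_pM2l p0) mulrDr exprVn mulfV ?gt_eqF// /w mulrA -expr2.
  rewrite -[(a _ - _) ^+ 2]real_normK ?num_real// -exprMn.
  by set t := 2 ^+ n * _; have := sqr_ge0 (t - 1); have := sqr_ge0 t; nra.
have ca : cvgn [normed series (telescope a)].
  apply: (series_le_cvg (v_ := (fun n => 2^-1 ^+ n : R) + w)) => // [n|n|].
  - exact: normr_ge0.
  - by rewrite -[leRHS]/(2^-1 ^+ n + w n) addr_ge0// exprn_ge0.
  rewrite (_ : series _ = series (fun n => 2^-1 ^+ n : R) + series w).
    exact: is_cvgD.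
  by apply/funext => n; rewrite seriesEnat/= big_split.
rewrite (_ : a = cst (a 0%N) + series (telescope a)).
  by apply: is_cvgD; [exact: is_cvg_cst|exact: normed_cvg].
by apply/funext => n; exact: eq_sum_telescope.
Qed.

Variable f : nat -> R -> R.
Hypothesis fL : forall n, f n \in L2.
Hypothesis f_rapid : forall n m, (n <= m)%N -> L2norm (f n - f m) <= 2^-1 ^+ n.

Let dL n m : f n - f m \in L2. Proof. exact: L2B. Qed.

(** The integral of 2^n (f (n+1) - f n)^2 is at most 2^n 4^-n = 2^-n, so the sum
    over n is integrable, hence finite almost everywhere. *)
Lemma rapid_L2_ae_cvg : {ae leb, forall x, cvgn (f^~ x)}.
Proof.
pose w n x := (2 ^+ n * (f n.+1 x - f n x) ^+ 2)%:E : \bar R.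
have mw n : measurable_fun setT (w n).
  apply/measurable_EFinP; apply: measurable_funM => //; apply: measurable_funX.
  exact: L2_measurable (dL _ _).
have w0 n x : (0 <= w n x)%E by rewrite lee_fin mulr_ge0 ?sqr_ge0// exprn_ge0.
have iw : (\int[leb]_x (\sum_(0 <= n <oo) w n x) < +oo)%E.
  rewrite integral_nneseries//.
  have wle n : (\int[leb]_x w n x <= (2^-1 ^+ n)%:E)%E.
    have p0 : (0 : R) < 2 ^+ n by rewrite exprn_gt0.
    have -> : (\int[leb]_x w n x =
        \int[leb]_x ((2 ^+ n)%:E * (((f n - f n.+1) x) ^+ 2)%:E))%E.
      by apply: eq_integral => x _; rewrite -EFinM -sqrrN opprB.
    rewrite ge0_integralZl//; first last.
    - by move=> x _; rewrite lee_fin sqr_ge0.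
    - by apply/measurable_EFinP; apply: measurable_funX; exact: L2_measurable (dL _ _).
    rewrite -L2norm_sqr// -EFinM lee_fin -ler_pdivlMl// -exprVn -expr2.
    by rewrite lerXn2r ?nnegrE ?L2norm_ge0 ?exprn_ge0// f_rapid.
  apply: (@le_lt_trans _ _ (\sum_(0 <= n <oo) (2^-1 ^+ n)%:E)%E).
    by apply: lee_nneseries => // n _ _; exact: integral_ge0.
  have cg : series (geometric 1 (2^-1 : R)) n @[n --> \oo] --> 1 / (1 - 2^-1 : R).
    by apply: cvg_geometric_series; rewrite ger0_norm// invf_lt1// ltr1n.
  rewrite (_ : (fun n => _) = EFin \o series (geometric 1 (2^-1 : R))).
    by rewrite EFin_lim ?ltry//; apply/cvg_ex; eexists; exact: cg.
  apply/funext => n; rewrite /= seriesEnat/= sumEFin; congr EFin.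
  by apply: eq_bigr => i _; rewrite /= mul1r.
have Sfin : {ae leb, forall x, setT x -> (\sum_(0 <= n <oo) w n x)%E \is a fin_num}.
  apply: integrable_ae => //; apply/integrableP; split.
    by apply: ge0_emeasurable_sum => // n _; exact: mw.
  by under eq_integral do rewrite gee0_abs ?nneseries_ge0//; exact: iw.
apply: filterS Sfin => x /(_ I) wx; apply: cvg_of_increments.
rewrite -ge0_fin_numE; first exact: wx.
by apply: nneseries_ge0 => n _ _; exact: w0.
Qed.

Lemma L2_complete : exists g, [/\ g \in L2,
  {ae leb, forall x, f n x @[n --> \oo] --> g x} &
  forall n, L2norm (f n - g) <= 2^-1 ^+ n].
Proof.
(* The upper limit is measurable, and equals the limit wherever there is one. *)
pose g x := fine (limn_esup (fun n => (f n x)%:E)).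
have mg : measurable_fun setT g.
  apply: measurableT_comp => //; apply: measurable_fun_limn_esup => n.
  apply/measurable_EFinP; exact: L2_measurable (fL n).
have fg : {ae leb, forall x, f n x @[n --> \oo] --> g x}.
  apply: filterS rapid_L2_ae_cvg => x /cvg_ex[l fl].
  suff -> : g x = l by [].
  have : (f n x)%:E @[n --> \oo] --> l%:E by apply: cvg_EFin; first exact: nearW.
  by move=> /cvg_limn_einf_sup[_]; rewrite /g => ->.
have dle n : (\int[leb]_x ((f n x - g x) ^+ 2)%:E <= ((2^-1 ^+ n) ^+ 2)%:E)%E.
  apply: (@le_integral_ae_cvg _ _ R leb (fun m x => (f n x - f (n + m)%N x) ^+ 2)).
  - by move=> m; apply: measurable_funX; exact: L2_measurable (dL _ _).
  - apply: measurable_funX; apply: measurable_funB => //; exact: L2_measurable (fL n).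
  - by move=> m x; exact: sqr_ge0.
  - apply: filterS fg => x fx.
    have fx' : f (n + m)%N x @[m --> \oo] --> g x.
      under eq_cvg do rewrite addnC.
      by have := fx; rewrite -(cvg_shiftn n (f^~ x)).
    rewrite expr2; under eq_cvg do rewrite expr2.
    by apply: cvgM; (apply: cvgB; [exact: cvg_cst|exact: fx']).
  - move=> m; rewrite -(L2norm_sqr (dL n (n + m))) lee_fin.
    by rewrite lerXn2r ?nnegrE ?L2norm_ge0 ?exprn_ge0// f_rapid// leq_addr.
have dgL n : (f n - g) \in L2.
  apply/L2P; split; last exact: le_lt_trans (dle n) (ltry _).
  by apply: measurable_funB => //; exact: L2_measurable (fL n).
exists g; split => //.
  rewrite (_ : g = (fun x => -1 * (f 0%N - g) x + f 0%N x)); first exact: L2_lin.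
  by apply/funext => x; rewrite mulN1r opprB subrK.
move=> n; rewrite -(@ler_pXn2r _ 2)// ?nnegrE ?L2norm_ge0 ?exprn_ge0//.
by rewrite -lee_fin (L2norm_sqr (dgL n)); exact: dle.
Qed.

End RieszFischer.
(** * Weak derivatives *)

Section WeakDerivative.
Context {R : realType}.
Implicit Types (u v w phi : R -> R) (A : set R).
Local Notation leb := (@lebesgue_measure R).
Local Notation L2 := (Lfun leb 2%:E).

Lemma indic_L2 A : measurable A -> (leb A < +oo)%E -> (\1_A : R -> R) \in L2.
Proof.
move=> mA Aoo; apply/L2P; split; first exact: measurable_indic.
rewrite (_ : (\int[leb]_x _ = leb A)%E)//.
have := integral_indic leb measurableT mA; rewrite setIT => <-.
apply: eq_integral => x _; congr EFin.
by rewrite indicE; case: (x \in A); rewrite ?expr1n// expr0n.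
Qed.

Lemma L2_integrable_on v A : v \in L2 -> measurable A -> (leb A < +oo)%E ->
  leb.-integrable A (EFin \o v).
Proof.
move=> vL mA Aoo; have [_] := @integrable_mkcond _ _ R leb A (EFin \o v) mA; apply.
have := L2_mul_integrable vL (indic_L2 mA Aoo).
apply: eq_integrable => // x _; rewrite /patch indicE /=.
by case: (x \in A); rewrite ?mulr1// mulr0.
Qed.

Lemma L2_locally_integrable v : v \in L2 -> locally_integrable setT v.
Proof.
move=> vL; split; [exact: L2_measurable|exact: openT|move=> K _ cK].
have mK := compact_measurable cK.
have /integrableP[_] := L2_integrable_on vL mK (compact_finite_measure cK).
by [].
Qed.

Lemma compact_support_L2 g K : continuous g -> compact K ->
  (forall x : R, ~ K x -> g x = 0) -> g \in L2.
Proof.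
move=> cg cK g0; apply/L2P; split; first exact: continuous_measurable_fun.
have mK := compact_measurable cK.
have : leb.-integrable K (EFin \o (fun x => g x ^+ 2)).
  apply: continuous_compact_integrable => //; apply: continuous_subspaceT => x.
  exact: (continuousM (cg x) (cg x)).
move=> /integrableP[_]; rewrite integral_mkcond; apply: le_lt_trans.
rewrite le_eqVlt; apply/orP; left; apply/eqP; apply: eq_integral => x _.
rewrite patchE; case: ifPn => [_|]; first by rewrite gee0_abs// lee_fin sqr_ge0.
by rewrite notin_setE => /g0 ->; rewrite expr0n.
Qed.

Lemma test_function_continuous phi n : test_function phi -> continuous (derive1n n phi).
Proof.
move=> [d _] x; apply: differentiable_continuous.
exact/derivable1_diffP.
Qed.

Lemma test_function_L2 phi : test_function phi -> phi \in L2.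
Proof.
move=> tp; have [_ cK] := tp; apply: compact_support_L2 cK _.
  by have := test_function_continuous (n := 0) tp; rewrite derive1n0.
move=> x; apply: contra_notP => /eqP px.
exact: subset_closure.
Qed.

Lemma test_function_derive_L2 phi : test_function phi -> derive1 phi \in L2.
Proof.
move=> tp; have [_ cK] := tp; apply: compact_support_L2 cK _.
  by have := test_function_continuous (n := 1) tp; rewrite derive1n1.
move=> x xK; rewrite derive1E (near_eq_derive (g := cst 0)) ?derive_cst//.
have oK : open (~` closure [set x | phi x != 0]).
  exact/closed_openC/closed_closure.
have : nbhs x (~` closure [set x | phi x != 0]) by exact: open_nbhs_nbhs.
apply: filterS => y /=; apply: contra_notP => /eqP py.
exact: subset_closure.
Qed.

(** Dominated convergence along bump a b n. *)
Lemma test_zero_itv v a b : v \in L2 ->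
  (forall phi, test_function phi -> \int[leb]_x (v x * phi x) = 0) ->
  \int[leb]_(x in `]a, b[) v x = 0.
Proof.
move=> vL v0.
have [ba|ab] := leP b a.
  by rewrite set_itv_ge ?bnd_simp -?leNgt// Rintegral_set0.
pose A := `]a, b[%classic : set R.
have mA : measurable A by exact: measurable_itv.
have Aoo : (leb A < +oo)%E by rewrite lebesgue_measure_itv/= lte_fin ab -EFinD; exact: ltry.
have iA := L2_mul_integrable vL (indic_L2 mA Aoo).
pose f n x := (v x * bump a b n x)%:E : \bar R.
have mb n : measurable_fun setT (bump a b n).
  exact: L2_measurable (test_function_L2 (bump_test a b n)).
have [] := @dominated_convergence _ _ R leb setT measurableT f
  (fun x => (v x * \1_A x)%:E) (fun x => (`|v x * \1_A x|)%:E).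
- move=> n; apply/measurable_EFinP; apply: measurable_funM; [exact: L2_measurable vL|exact: mb].
- exact: measurable_int iA.
- apply: aeW => x _; apply: cvg_EFin; first exact: nearW.
  apply: cvgM; first exact: cvg_cst.
  rewrite indicE; case: (boolP (x \in A)) => [|]; rewrite ?inE.
    exact: bump_cvg.
  rewrite notin_setE => xA; have xA' : x \notin `]a, b[ by exact/negP.
  by apply: cvg_near_cst; apply: nearW => n; rewrite /= bump_out.
- exact: integrable_abse iA.
- apply: aeW => x n _; rewrite /f /= lee_fin !normrM ler_wpM2l//.
  rewrite (ger0_norm (bump_ge0 _ _ _ _)) indicE.
  case: (boolP (x \in A)) => [_|]; first by rewrite normr1 bump_le1.
  rewrite notin_setE => xA; have xA' : x \notin `]a, b[ by exact/negP.
  by rewrite bump_out// normr0.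
move=> _ _.
have f0 n : (\int[leb]_x f n x = 0)%E.
  rewrite -[LHS]fineK; first by congr EFin; exact: v0 (bump_test a b n).
  apply: integrable_fin_num => //.
  exact: L2_mul_integrable vL (test_function_L2 (bump_test a b n)).
rewrite (_ : [sequence _]_n = cst 0%E); last by apply/funext => n; exact: f0.
move=> /(cvg_lim (@ereal_hausdorff R)); rewrite lim_cst; last exact: ereal_hausdorff.
move=> i0; rewrite /Rintegral integral_mkcond.
rewrite (_ : (\int[leb]_x _ = 0)%E)// i0; apply: eq_integral => x _.
by rewrite patchE indicE; case: ifPn; rewrite ?mulr1// mulr0.
Qed.

(** The primitive of v vanishes identically, and v is its derivative almost
    everywhere. As v is only locally integrable, the primitives start at -n for
    each natural number n. *)
Lemma test_zero_ae v : v \in L2 ->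
  (forall phi, test_function phi -> \int[leb]_x (v x * phi x) = 0) ->
  {ae leb, forall x, v x = 0}.
Proof.
move=> vL v0.
have intv (M y : R) : leb.-integrable `]M, y] (EFin \o v).
  apply: L2_integrable_on => //.
  by rewrite lebesgue_measure_itv/=; case: ifP => _; rewrite -?EFinD ltry.
have aeM (n : nat) : {ae leb, forall x, - n%:R < x -> v x = 0}.
  apply: filterS (FTC1 (intv (- n%:R)) (L2_locally_integrable vL)) => x H nx.
  have [|_ <-] := H; first exact: nx.
  rewrite (_ : (fun _ => _) = cst 0); first exact: derive1_cst.
  apply/funext => y; rewrite -Rintegral_itv_bndo_bndc; first exact: test_zero_itv.
  apply: integrableS (intv (- n%:R) y) => // z /=.
  by rewrite !in_itv/= => /andP[-> /ltW].
have : {ae leb, forall x (n : nat), - n%:R < x -> v x = 0}.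
  exact: (@ae_foralln _ _ R leb (fun n x => - n%:R < x -> v x = 0)).
apply: filterS => x /(_ (Num.truncn `|x|).+1); apply.
by rewrite ltrNl (le_lt_trans (ler_norm _))// normrN truncnS_gt.
Qed.

Lemma weak_derivative_lin a u v u' v' : u \in L2 -> v \in L2 -> u' \in L2 -> v' \in L2 ->
  is_weak_derivative u u' -> is_weak_derivative v v' ->
  is_weak_derivative (fun x => a * u x + v x) (fun x => a * u' x + v' x).
Proof.
have lin f g phi : f \in L2 -> g \in L2 -> phi \in L2 ->
    \int[leb]_x ((a * f x + g x) * phi x) =
    a * \int[leb]_x (f x * phi x) + \int[leb]_x (g x * phi x).
  move=> fL gL pL; have fi := L2_mul_integrable fL pL.
  rewrite -RintegralZl// -RintegralD//; last 2 first.
  - by apply: eq_integrable (integrableZl measurableT a fi).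
  - exact: L2_mul_integrable gL pL.
  by apply: eq_Rintegral => x _; rewrite mulrDl mulrA.
move=> uL vL u'L v'L wu wv phi tp.
have [pL dpL] := (test_function_L2 tp, test_function_derive_L2 tp).
by rewrite !lin// wu// wv// mulrN opprD.
Qed.

Lemma weak_derivative_unique u w w' : w \in L2 -> w' \in L2 ->
  is_weak_derivative u w -> is_weak_derivative u w' -> {ae leb, forall x, w x = w' x}.
Proof.
move=> wL w'L uw uw'.
have dL := L2_lin (-1) w'L wL.
suff : {ae leb, forall x, -1 * w' x + w x = 0}.
  by apply: filterS => x; rewrite mulN1r addrC => /eqP; rewrite subr_eq0 => /eqP.
apply: test_zero_ae => // phi tp; have pL := test_function_L2 tp.
have iw := L2_mul_integrable wL pL; have iw' := L2_mul_integrable w'L pL.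
have e : \int[leb]_x (w x * phi x) = \int[leb]_x (w' x * phi x).
  by apply: oppr_inj; rewrite -uw// uw'.
rewrite (_ : \int[leb]_x _ = \int[leb]_x (w x * phi x - w' x * phi x)).
  by rewrite RintegralB// e subrr.
by apply: eq_Rintegral => x _; rewrite mulN1r addrC mulrBl.
Qed.

(** Both sides of the defining identity are continuous for the L^2 norm,
    because test functions and their derivatives lie in L^2. *)
Lemma weak_derivative_limit (u w : nat -> R -> R) (ul wl : R -> R) :
  (forall n, u n \in L2) -> (forall n, w n \in L2) -> ul \in L2 -> wl \in L2 ->
  (forall n, L2norm (u n - ul) <= 2^-1 ^+ n) ->
  (forall n, L2norm (w n - wl) <= 2^-1 ^+ n) ->
  (forall n, is_weak_derivative (u n) (w n)) -> is_weak_derivative ul wl.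
Proof.
move=> uL wL ulL wlL ule wle uw phi tp.
have [pL dpL] := (test_function_L2 tp, test_function_derive_L2 tp).
have cvg_int (f : nat -> R -> R) (fl psi : R -> R) :
    (forall n, f n \in L2) -> fl \in L2 -> psi \in L2 ->
    (forall n, L2norm (f n - fl) <= 2^-1 ^+ n) ->
    \int[leb]_x (f n x * psi x) @[n --> \oo] --> \int[leb]_x (fl x * psi x).
  move=> fL flL psiL fle; apply: cvg_sub0 (cvg_cst _).
  have c0 : 2^-1 ^+ n * L2norm psi @[n --> \oo] --> (0 : R).
    rewrite -(mul0r (L2norm psi)); apply: cvgM; last exact: cvg_cst.
    by apply: cvg_expr; rewrite ger0_norm// invf_lt1// ltr1n.
  apply: norm_cvg0; apply: (squeeze_cvgr _ (cvg_cst 0) c0).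
  apply: nearW => n; rewrite normr_ge0/=.
  have dL : f n - fl \in L2 by exact: L2B.
  rewrite -[X in `|X|]/(\int[leb]_x (f n x * psi x) - \int[leb]_x (fl x * psi x)).
  rewrite -RintegralB//; [|exact: L2_mul_integrable|exact: L2_mul_integrable].
  rewrite (_ : \int[leb]_x _ = \int[leb]_x ((f n - fl) x * psi x)); last first.
    by apply: eq_Rintegral => x _; rewrite -mulrBl.
  by rewrite (le_trans (Rintegral_mul_le dL psiL))// ler_wpM2r ?L2norm_ge0.
have c1 := cvg_int _ _ _ uL ulL dpL ule.
have c2 : (- \int[leb]_x (w n x * phi x)) @[n --> \oo] --> - \int[leb]_x (wl x * phi x).
  by apply: cvgN; exact: cvg_int.
have e : (fun n => \int[leb]_x (u n x * derive1 phi x)) =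
    (fun n => - \int[leb]_x (w n x * phi x)) by apply/funext => n; exact: uw.
rewrite e in c1; rewrite -(cvg_lim (@Rhausdorff R) c1).
exact: cvg_lim.
Qed.

End WeakDerivative.
(** * The space H^1 *)

Section H1Space.
Context {R : realType}.
Implicit Types (u v w : R -> R).
Local Notation leb := (@lebesgue_measure R).
Local Notation L2 := (Lfun leb 2%:E).

Lemma weak_derivativeP u : H1 u -> L2_weak_derivatives u (weak_derivative u).
Proof. by move=> [_ [w uw]]; exact: (xgetPex (cst 0) (ex_intro _ w uw)). Qed.

(** Frees the H^1 norm from the representative chosen by weak_derivative: two
    weak derivatives in L^2 agree almost everywhere. *)
Lemma H1normE u w : u \in L2 -> L2_weak_derivatives u w ->
  H1norm u = Num.sqrt (L2norm w ^+ 2 + L2norm u ^+ 2).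
Proof.
move=> uL uw; have [w'L uw'] : L2_weak_derivatives u (weak_derivative u).
  by apply: weak_derivativeP; split => //; exists w.
have [wL {}uw] := uw.
rewrite /H1norm (@L2norm_ae _ (weak_derivative u) w)//.
exact: weak_derivative_unique uw' uw.
Qed.

Lemma L2_weak_derivatives_0 : L2_weak_derivatives (fun=> 0 : R) (fun=> 0).
Proof.
split; first exact: L2_0.
move=> phi _; under eq_Rintegral do rewrite mul0r.
by rewrite Rintegral_cst// mul0r; under eq_Rintegral do rewrite mul0r;
  rewrite Rintegral_cst// mul0r oppr0.
Qed.

Lemma H1_0 : H1 (fun=> 0 : R).
Proof.
by split; [exact: L2_0|exists (fun=> 0); exact: L2_weak_derivatives_0].
Qed.

Lemma L2_weak_derivatives_lin a u v u' v' : u \in L2 -> v \in L2 ->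
  L2_weak_derivatives u u' -> L2_weak_derivatives v v' ->
  L2_weak_derivatives (fun x => a * u x + v x) (fun x => a * u' x + v' x).
Proof.
move=> uL vL [u'L uu'] [v'L vv']; split; first exact: L2_lin.
exact: weak_derivative_lin.
Qed.

Lemma H1_lin a u v : H1 u -> H1 v -> H1 (fun x => a * u x + v x).
Proof.
move=> [uL [u' uu']] [vL [v' vv']]; split; first exact: L2_lin.
by exists (fun x => a * u' x + v' x); exact: L2_weak_derivatives_lin.
Qed.

Lemma sqrt_minkowski (a b c d : R) :
  Num.sqrt ((a + c) ^+ 2 + (b + d) ^+ 2) <=
  Num.sqrt (a ^+ 2 + b ^+ 2) + Num.sqrt (c ^+ 2 + d ^+ 2).
Proof.
set p := a ^+ 2 + b ^+ 2; set q := c ^+ 2 + d ^+ 2.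
have p0 : 0 <= p by rewrite addr_ge0 ?sqr_ge0.
have q0 : 0 <= q by rewrite addr_ge0 ?sqr_ge0.
have cs : a * c + b * d <= Num.sqrt p * Num.sqrt q.
  apply: le_trans (ler_norm _) _; rewrite -sqrtrM// -sqrtr_sqr ler_wsqrtr//.
  by rewrite /p /q; have := sqr_ge0 (a * d - b * c); nra.
rewrite -(@ler_pXn2r _ 2)// ?nnegrE ?addr_ge0 ?sqrtr_ge0//.
rewrite sqr_sqrtr ?addr_ge0 ?sqr_ge0// [leRHS]sqrrD !sqr_sqrtr//.
rewrite /p /q in cs *; nra.
Qed.

Lemma H1normD u v : H1 u -> H1 v -> H1norm (u + v) <= H1norm u + H1norm v.
Proof.
move=> Hu Hv; have [[uL _] [vL _]] := (Hu, Hv).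
have [du dv] := (weak_derivativeP Hu, weak_derivativeP Hv).
set u' := weak_derivative u in du *; set v' := weak_derivative v in dv *.
have e f g : f + g = (fun x => 1 * f x + g x) :> (R -> R).
  by apply/funext => x; rewrite mul1r.
have uvL : u + v \in L2 by rewrite e; exact: L2_lin.
have duv : L2_weak_derivatives (u + v) (u' + v').
  by rewrite !e; exact: L2_weak_derivatives_lin.
rewrite (H1normE uvL duv) (H1normE uL du) (H1normE vL dv).
have [[u'L _] [v'L _]] := (du, dv).
apply: le_trans (sqrt_minkowski _ _ _ _).
by rewrite ler_wsqrtr// lerD// lerXn2r ?nnegrE ?addr_ge0 ?L2norm_ge0// L2normD.
Qed.

Lemma H1normZ a u : H1 u -> H1norm (fun x => a * u x) = `|a| * H1norm u.
Proof.
move=> Hu; have [[uL _] du] := (Hu, weak_derivativeP Hu).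
set u' := weak_derivative u in du *.
have e (f : R -> R) : (fun x => a * f x) = (fun x => a * f x + 0).
  by apply/funext => x; rewrite addr0.
have auL : (fun x => a * u x) \in L2 by rewrite e; exact: L2_lin L2_0.
have dau : L2_weak_derivatives (fun x => a * u x) (fun x => a * u' x).
  rewrite (e u) (e u'); exact: L2_weak_derivatives_lin uL L2_0 du L2_weak_derivatives_0.
rewrite (H1normE auL dau) (H1normE uL du); have [u'L _] := du.
by rewrite !L2normZ// !exprMn -mulrDr sqrtrM ?sqr_ge0// sqrtr_sqr normr_id.
Qed.

Lemma L2norm_le_H1norm u : L2norm u <= H1norm u.
Proof.
rewrite -[leLHS]ger0_norm ?L2norm_ge0// -sqrtr_sqr ler_wsqrtr// lerDr.
by rewrite sqr_ge0.
Qed.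

Lemma H1norm_ge0 u : 0 <= H1norm u. Proof. exact: sqrtr_ge0. Qed.

Lemma H1norm_le u w : u \in L2 -> L2_weak_derivatives u w ->
  H1norm u <= L2norm w + L2norm u.
Proof.
move=> uL uw; rewrite (H1normE uL uw).
rewrite -[leRHS]ger0_norm ?addr_ge0 ?L2norm_ge0// -sqrtr_sqr ler_wsqrtr//.
have := L2norm_ge0 w; have := L2norm_ge0 u; nra.
Qed.

Lemma H1norm_ae0 u : u \in L2 -> {ae leb, forall x, u x = 0} -> H1norm u = 0.
Proof.
move=> uL u0; have n0 : L2norm u = 0.
  rewrite (L2norm_ae uL L2_0 u0).
  rewrite (_ : (fun=> 0) = (fun x => 0 * u x)); last by apply/funext => x; rewrite mul0r.
  by rewrite (L2normZ 0 uL) normr0 mul0r.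
have d0 : L2_weak_derivatives u u.
  split=> // phi tp.
  have i0 f : f \in L2 -> \int[leb]_x (u x * f x) = 0.
    move=> fL; apply/eqP; rewrite -normr_le0.
    by rewrite (le_trans (Rintegral_mul_le uL fL))// n0 mul0r.
  by rewrite !i0 ?oppr0//; [exact: test_function_L2|exact: test_function_derive_L2].
by apply/eqP; rewrite eq_le H1norm_ge0 (le_trans (H1norm_le uL d0))// n0 addr0.
Qed.

(** L2_complete applies to the functions and to their weak derivatives
    separately; the almost everywhere convergence is kept for the energy. *)
Lemma H1_complete (f : nat -> R -> R) : (forall n, H1 (f n)) ->
  (forall n m, (n <= m)%N -> H1norm (f n - f m) <= 2^-1 ^+ n) ->
  exists u, [/\ H1 u, {ae leb, forall x, f n x @[n --> \oo] --> u x} &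
    forall n, H1norm (f n - u) <= 2 * 2^-1 ^+ n].
Proof.
move=> fH rapid.
have fL n : f n \in L2 by have [] := fH n.
have eB (g h : R -> R) : g - h = (fun x => -1 * h x + g x).
  by apply/funext => x; rewrite mulN1r addrC.
pose w n := weak_derivative (f n).
have dw n : L2_weak_derivatives (f n) (w n) by exact: weak_derivativeP.
have wL n : w n \in L2 by have [] := dw n.
have dB (g h g' h' : R -> R) : g \in L2 -> h \in L2 -> L2_weak_derivatives g g' ->
    L2_weak_derivatives h h' -> L2_weak_derivatives (g - h) (g' - h').
  by rewrite !eB => gL hL dg dh; exact: L2_weak_derivatives_lin.
have [n m nm|u [uL fu fule]] := L2_complete fL.
  exact: le_trans (L2norm_le_H1norm _) (rapid n m nm).
have [n m nm|u' [u'L _ wule]] := L2_complete wL.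
  apply: le_trans (rapid n m nm).
  rewrite (H1normE (L2B (fL n) (fL m)) (dB _ _ _ _ (fL n) (fL m) (dw n) (dw m))).
  by rewrite -[leLHS]ger0_norm ?L2norm_ge0// -sqrtr_sqr ler_wsqrtr// lerDl sqr_ge0.
have du : L2_weak_derivatives u u'.
  split=> //; apply: (weak_derivative_limit fL wL uL u'L fule wule) => n.
  by have [] := dw n.
exists u; split => //; first by split => //; exists u'.
move=> n; rewrite mulr_natl mulr2n.
apply: le_trans (H1norm_le (L2B (fL n) uL) (dB _ _ _ _ (fL n) uL (dw n) du)) _.
exact: lerD.
Qed.

End H1Space.
(** * The quartic energy *)

Section Energy.
Context {R : realType} (G : R -> R -> R).
Hypothesis G_meas : measurable_fun [set: R * R] (fun z : R * R => G z.1 z.2).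
Hypothesis G_ge0 : forall x y, 0 <= G x y.
Implicit Types (f g u v : R -> R).
Local Notation leb := (@lebesgue_measure R).
Local Notation leb2 := (leb \x leb)%E.
Local Notation L2 := (Lfun leb 2%:E).

#[local] Instance lebesgue2_ae_filter : Filter (nbhs (almost_everywhere leb2)) :=
  ae_filter_ringOfSetsType leb2.

Lemma ae_prod (P : R -> Prop) : {ae leb, forall x, P x} ->
  {ae leb2, forall z : R * R, P z.1 /\ P z.2}.
Proof.
move=> [A [mA A0 PA]].
exists (A `*` setT `|` setT `*` A); split.
- by apply: measurableU; apply: measurableX.
- apply: null_set_setU; [exact: measurableX|exact: measurableX| |].
    exact: etrans (product_measure1E leb leb mA measurableT)
      (etrans (congr1 (fun e => e * leb setT)%E A0) (mul0e _)).
  exact: etrans (product_measure1E leb leb measurableT mA)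
    (etrans (congr1 (fun e => leb setT * e)%E A0) (mule0 _)).
- move=> z /= Pz; have [A1|nA1] := pselect (A z.1); first by left.
  right; split => //; apply: (PA) => /= Pz2; apply: Pz; split => //.
  by apply: contrapT => Pz1; apply: nA1; exact: PA.
Qed.

Lemma energy_measurable f : measurable_fun setT f ->
  measurable_fun setT (fun z : R * R => f z.1 * f z.2 * G z.1 z.2).
Proof.
move=> mf; apply: measurable_funM => //; apply: measurable_funM.
  exact: measurableT_comp.
exact: measurableT_comp.
Qed.

Lemma energy_integrand_ge0 f (z : R * R) : (forall x, 0 <= f x) ->
  0 <= f z.1 * f z.2 * G z.1 z.2.
Proof. by move=> f0; rewrite !mulr_ge0. Qed.

Lemma Bform_ge0 f : (forall x, 0 <= f x) -> (0 <= Bform G f)%E.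
Proof. by move=> f0; apply: integral_ge0 => z _; rewrite lee_fin energy_integrand_ge0. Qed.

Lemma Bform_fin f : (forall x, 0 <= f x) -> (Bform G f < +oo)%E ->
  (fine (Bform G f))%:E = Bform G f.
Proof. by move=> f0 foo; rewrite fineK// ge0_fin_numE// Bform_ge0. Qed.

Lemma le_Bform f g : measurable_fun setT f -> measurable_fun setT g ->
  (forall x, 0 <= f x) -> (forall x, f x <= g x) -> (Bform G f <= Bform G g)%E.
Proof.
move=> mf mg f0 fg; apply: ge0_le_integral => //.
- by move=> z _; rewrite lee_fin energy_integrand_ge0.
- by apply/measurable_EFinP; exact: energy_measurable.
- by apply/measurable_EFinP; exact: energy_measurable.
- by move=> z _; rewrite lee_fin ler_wpM2r// ler_pM.
Qed.

Lemma BformZ (c : R) f : measurable_fun setT f -> (forall x, 0 <= f x) ->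
  Bform G (fun x => c * f x) = ((c ^+ 2)%:E * Bform G f)%E.
Proof.
move=> mf f0; rewrite /Bform /bform -ge0_integralZl//.
- by apply: eq_integral => z _; rewrite /form_integrand -EFinM; congr EFin; ring.
- by apply/measurable_EFinP; exact: energy_measurable.
- by move=> z _; rewrite lee_fin energy_integrand_ge0.
- by rewrite lee_fin sqr_ge0.
Qed.

Lemma energy_integrable f : measurable_fun setT f -> (forall x, 0 <= f x) ->
  (Bform G f < +oo)%E ->
  leb2.-integrable setT (fun z => (f z.1 * f z.2 * G z.1 z.2)%:E).
Proof.
move=> mf f0 foo; apply/integrableP; split.
  by apply/measurable_EFinP; exact: energy_measurable.
move: foo; rewrite /Bform /bform; congr (_ < _)%E.
by apply: eq_integral => z _; rewrite gee0_abs// lee_fin energy_integrand_ge0.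
Qed.

(** The convergence holds at both coordinates of almost every pair (ae_prod),
    so Fatou's lemma applies to the product measure. *)
Lemma Bform_lsc (f : nat -> R -> R) u (c : \bar R) :
  (forall n, measurable_fun setT (f n)) -> measurable_fun setT u ->
  {ae leb, forall x, f n x @[n --> \oo] --> u x} ->
  (forall n, Bform G (fun x => f n x ^+ 2)%R <= c)%E -> (Bform G (fun x => u x ^+ 2)%R <= c)%E.
Proof.
move=> mf mu fu fc.
have sq (x : R) : 0 <= x ^+ 2 by exact: sqr_ge0.
apply: (@le_integral_ae_cvg _ _ R leb2
  (fun n z => f n z.1 ^+ 2 * f n z.2 ^+ 2 * G z.1 z.2)) => //.
- by move=> n; apply: (energy_measurable (f := fun x => f n x ^+ 2)); exact: measurable_funX.
- by apply: (energy_measurable (f := fun x => u x ^+ 2)); exact: measurable_funX.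
- by move=> n z; apply: mulr_ge0 => //; apply: mulr_ge0; exact: sqr_ge0.
- have := ae_prod fu; apply: filterS => z [f1 f2].
  apply: cvgM; last exact: cvg_cst.
  by apply: cvgM; [exact: (cvgM f1 f1)|exact: (cvgM f2 f2)].
Qed.

Lemma Bform_ae0 u : measurable_fun setT u -> {ae leb, forall x, u x = 0} ->
  Bform G (fun x => u x ^+ 2) = 0.
Proof.
move=> mu u0; apply/eqP; rewrite eq_le Bform_ge0 ?andbT; last by move=> x; exact: sqr_ge0.
apply: (Bform_lsc (f := fun n => cst 0)) => //.
  by apply: filterS u0 => x ->; exact: cvg_cst.
move=> n; rewrite /Bform /bform integral0_eq// => z _.
by rewrite /form_integrand /= expr0n/= !mul0r.
Qed.

Hypothesis G_psd : pos_semidef G.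

(** Positivity is applied to h = (1 - s) f - s g. As f and g are nonnegative,
    the cross terms of h(x) h(y) are nonpositive, so the positive part of its
    integrand is dominated by the energies of f and g; the energy of h is thus
    defined, and nonnegativity then forces the negative part to be integrable
    as well. *)
Lemma energy_convex f g (s : R) : f \in Lfun leb 1%E -> g \in Lfun leb 1%E ->
  (forall x, 0 <= f x) -> (forall x, 0 <= g x) ->
  (Bform G f < +oo)%E -> (Bform G g < +oo)%E -> 0 < s -> s < 1 ->
  (Bform G (fun x => f x + g x)%R <=
   (s^-1 * fine (Bform G f) + (1 - s)^-1 * fine (Bform G g))%:E)%E.
Proof.
move=> fL gL f0 g0 foo goo s0 s1.
have mL h : h \in Lfun leb 1%E -> measurable_fun setT h.
  by rewrite inE => /andP[/[!inE]].
have [mf mg] := (mL _ fL, mL _ gL).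
pose t := 1 - s; have t0 : 0 < t by rewrite subr_gt0.
pose h x := t * f x + (- s) * g x.
have hL : h \in Lfun leb 1%E.
  have [_ lin] := @Lfun_submod_closed _ _ R leb 1%E (lexx _).
  rewrite (_ : h = t *: f + ((- s) *: g + 0)); last by apply/funext => x; rewrite /h addr0.
  apply: (lin) => //; apply: (lin) => //.
  by have [] := @Lfun_submod_closed _ _ R leb 1%E (lexx _).
pose F k (z : R * R) := k z.1 * k z.2 * G z.1 z.2.
have iF : leb2.-integrable setT (EFin \o F f) by exact: energy_integrable.
have iG : leb2.-integrable setT (EFin \o F g) by exact: energy_integrable.
have mH : measurable_fun setT (EFin \o F h).
  by apply/measurable_EFinP; apply: energy_measurable; exact: mL.
have iZ (c : R) k : leb2.-integrable setT (EFin \o F k) ->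
    leb2.-integrable setT (EFin \o (fun z => c * F k z)).
  by move=> ik; exact: (integrableZl measurableT c ik).
(* The integrand of h without its nonpositive cross terms. *)
pose K z := t ^+ 2 * F f z + s ^+ 2 * F g z.
have iK : leb2.-integrable setT (EFin \o K).
  exact: (integrableD measurableT (iZ _ _ iF) (iZ _ _ iG)).
have F0 k z : (forall x, 0 <= k x) -> 0 <= F k z by move=> k0; rewrite !mulr_ge0.
have HK z : F h z <= K z.
  have c1 := mulr_ge0 (mulr_ge0 (f0 z.1) (g0 z.2)) (G_ge0 z.1 z.2).
  have c2 := mulr_ge0 (mulr_ge0 (g0 z.1) (f0 z.2)) (G_ge0 z.1 z.2).
  have st := mulr_ge0 (ltW s0) (ltW t0).
  have := mulr_ge0 st (addr_ge0 c1 c2).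
  rewrite /F /h /K /F; move: (f z.1) (f z.2) (g z.1) (g z.2) (G z.1 z.2) => *; nra.
have Hpos : (\int[leb2]_z (form_integrand G h h)^\+ z < +oo)%E.
  have /integrableP[_] := iK; apply: le_lt_trans; apply: ge0_le_integral => //.
  - exact: measurable_funepos.
  - by apply: measurableT_comp => //; exact: measurable_int iK.
  - move=> z _; rewrite funeposE ge_max abse_ge0 andbT /=.
    by rewrite lee_fin (le_trans (HK z))// ler_norm.
have H0 := G_psd hL (or_introl Hpos).
have Hneg : (\int[leb2]_z (form_integrand G h h)^\- z < +oo)%E.
  rewrite ltey; apply: contraTneq H0 => Hny.
  rewrite /bform integralE Hny -ltNge; move: Hpos.
  set a := (X in (X - _)%E); rewrite -[X in (X < _)%E -> _]/a.
  by case: a => [r||]//= _; rewrite ltNyr.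
have iH : leb2.-integrable setT (EFin \o F h).
  apply/integrableP; split => //.
  have -> : (fun z => `|(EFin \o F h) z|)%E =
      ((form_integrand G h h)^\+ \+ (form_integrand G h h)^\-)%E.
    exact: (fune_abse (form_integrand G h h)).
  rewrite ge0_integralD//; first exact: lte_add_pinfty.
  - exact: measurable_funepos.
  - exact: measurable_funeneg.
have s0' : s != 0 by rewrite gt_eqF.
have t0' : t != 0 by rewrite gt_eqF.
have key z : F (fun x => f x + g x) z = s^-1 * F f z + t^-1 * F g z - (s * t)^-1 * F h z.
  by rewrite /F /h; rewrite /t in t0' *; field; rewrite s0' t0'.
have iS : leb2.-integrable setT (EFin \o (fun z => s^-1 * F f z + t^-1 * F g z)).
  exact: (integrableD measurableT (iZ _ _ iF) (iZ _ _ iG)).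
have ifg : leb2.-integrable setT (EFin \o F (fun x => f x + g x)).
  apply: (eq_integrable measurableT _ _ _ (integrableB measurableT iS (iZ (s * t)^-1 _ iH))).
  by move=> z _; rewrite /= -EFinB key.
have -> : Bform G (fun x => f x + g x) = (\int[leb2]_z F (fun x => f x + g x) z)%:E.
  by rewrite /Rintegral fineK//; exact: integrable_fin_num.
rewrite lee_fin.
under eq_Rintegral do rewrite key.
rewrite RintegralB//; [|exact: iZ].
rewrite RintegralD//; [|exact: iZ|exact: iZ].
rewrite !RintegralZl// lerBlDr lerDl mulr_ge0 ?invr_ge0 ?mulr_ge0 ?(ltW s0) ?(ltW t0)//.
by rewrite fine_ge0.
Qed.


Lemma sqr_Lfun1 u : u \in L2 -> (fun x => u x ^+ 2) \in Lfun leb 1%E.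
Proof. by move=> uL; apply/Lfun1_integrable; exact: Lfun2_integrable_sqr. Qed.

(** The energy is monotone on nonnegative functions, so convexity of the square
    reduces the claim to energy_convex for u^2 / s and v^2 / (1 - s), whose
    quadratic scaling contributes the two missing powers. *)
Lemma energy_quartic u v (s : R) : u \in L2 -> v \in L2 ->
  (Bform G (fun x => u x ^+ 2)%R < +oo)%E -> (Bform G (fun x => v x ^+ 2)%R < +oo)%E ->
  0 < s -> s < 1 ->
  (Bform G (fun x => (u x + v x) ^+ 2)%R <=
   (fine (Bform G (fun x => u x ^+ 2)%R) / s ^+ 3 +
    fine (Bform G (fun x => v x ^+ 2)%R) / (1 - s) ^+ 3)%:E)%E.
Proof.
move=> uL vL uoo voo s0 s1.
have t0 : 0 < 1 - s by rewrite subr_gt0.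
have [mu mv] := (L2_measurable uL, L2_measurable vL).
have mZ (c : R) (w : R -> R) : measurable_fun setT w ->
    measurable_fun setT (fun x => c * w x ^+ 2).
  by move=> mw; apply: measurable_funM => //; exact: measurable_funX.
have L1Z (c : R) (w : R -> R) : w \in L2 -> (fun x => c * w x ^+ 2) \in Lfun leb 1%E.
  move=> wL; have := Lfun_scale c (lexx 1) (sqr_Lfun1 wL).
  by rewrite (_ : c \o* _ = (fun x => c * w x ^+ 2))//; apply/funext => x; exact: mulrC.
have Z0 (c : R) (w : R -> R) x : 0 < c -> 0 <= c * w x ^+ 2.
  by move=> c0; rewrite mulr_ge0 ?sqr_ge0// ltW.
have BZ (c : R) (w : R -> R) : measurable_fun setT w ->
    (Bform G (fun x => w x ^+ 2)%R < +oo)%E ->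
    Bform G (fun x => c * w x ^+ 2) = (c ^+ 2 * fine (Bform G (fun x => w x ^+ 2)))%:E.
  move=> mw woo; rewrite (BformZ c (measurable_funX 2 mw)); last by move=> x; exact: sqr_ge0.
  by rewrite [RHS]EFinM Bform_fin// => x; exact: sqr_ge0.
have s'0 : 0 < s^-1 by rewrite invr_gt0.
have t'0 : 0 < (1 - s)^-1 by rewrite invr_gt0.
apply: (@le_trans _ _ (Bform G (fun x => s^-1 * u x ^+ 2 + (1 - s)^-1 * v x ^+ 2))).
  apply: le_Bform.
  - by apply: measurable_funX; exact: measurable_funD.
  - by apply: measurable_funD; exact: mZ.
  - by move=> x; exact: sqr_ge0.
  - move=> x; rewrite -subr_ge0.
    have -> : s^-1 * u x ^+ 2 + (1 - s)^-1 * v x ^+ 2 - (u x + v x) ^+ 2 =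
        (s * (1 - s))^-1 * ((1 - s) * u x - s * v x) ^+ 2.
      by field; rewrite !gt_eqF.
    by rewrite mulr_ge0 ?sqr_ge0// invr_ge0 mulr_ge0// ltW.
have := @energy_convex _ _ s (L1Z s^-1 _ uL) (L1Z (1 - s)^-1 _ vL)
  (fun x => Z0 _ u x s'0) (fun x => Z0 _ v x t'0) _ _ s0 s1.
rewrite !BZ// => /(_ (ltry _) (ltry _)) /le_trans; apply.
rewrite lee_fin le_eqVlt; apply/orP; left; apply/eqP.
by rewrite /=; field; rewrite !gt_eqF.
Qed.

Lemma root4K (x : R) : 0 <= x -> (x `^ 4^-1) ^+ 4 = x.
Proof. by move=> x0; rewrite -powR_mulrn ?powR_ge0// -powRrM mulVf// powRr1. Qed.

(** The weight s = a / (a + b) makes x / s^3 + y / (1 - s)^3 equal to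
    (a + b)^4 when x = a^4 and y = b^4; a small shift of a and b handles the
    case where one of them vanishes. *)
Lemma root4_le_add (x y z : R) : 0 <= x -> 0 <= y -> 0 <= z ->
  (forall s, 0 < s -> s < 1 -> z <= x / s ^+ 3 + y / (1 - s) ^+ 3) ->
  z `^ 4^-1 <= x `^ 4^-1 + y `^ 4^-1.
Proof.
move=> x0 y0 z0 H; apply/ler_addgt0Pr => e e0.
set a := x `^ _; set b := y `^ _.
have [a0 b0] : 0 <= a /\ 0 <= b by rewrite !powR_ge0.
pose p := a + e / 2; pose q := b + e / 2.
have e2 : 0 < e / 2 by rewrite divr_gt0.
have [p0 q0] : 0 < p /\ 0 < q by rewrite !ltr_wpDl.
have pq0 : 0 < p + q by rewrite addr_gt0.
have := H (p / (p + q)); rewrite divr_gt0// ltr_pdivrMr// mul1r ltrDl q0 => /(_ isT isT) zle.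
have : z <= (p + q) ^+ 4.
  apply: (le_trans zle).
  have -> : 1 - p / (p + q) = q / (p + q) by field; rewrite gt_eqF.
  have -> : (p + q) ^+ 4 = p ^+ 4 / (p / (p + q)) ^+ 3 + q ^+ 4 / (q / (p + q)) ^+ 3.
    by field; rewrite !gt_eqF.
  rewrite -(root4K x0) -(root4K y0) -/a -/b.
  apply: lerD; (rewrite ler_pM2r ?invr_gt0 ?exprn_gt0 ?divr_gt0//;
    rewrite lerXn2r ?nnegrE ?(ltW p0) ?(ltW q0)// lerDl ltW//).
rewrite -{1}(root4K z0) ler_pXn2r// ?nnegrE ?powR_ge0 ?(ltW pq0)//.
by move=> /le_trans; apply; rewrite /p /q le_eqVlt; apply/orP; left; apply/eqP; lra.
Qed.

Definition finite_energy u := u \in L2 /\ (Bform G (fun x => u x ^+ 2)%R < +oo)%E.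

Let sqr0 u x : 0 <= u x ^+ 2. Proof. exact: sqr_ge0. Qed.

Lemma finite_energyD u v : finite_energy u -> finite_energy v ->
  (Bform G (fun x => (u x + v x) ^+ 2)%R < +oo)%E.
Proof.
move=> [uL uoo] [vL voo]; apply: le_lt_trans (ltry _).
by apply: (energy_quartic (s := 2^-1)) => //; rewrite invf_lt1// ltr1n.
Qed.

Lemma BnormD u v : finite_energy u -> finite_energy v ->
  Bnorm G (u + v) <= Bnorm G u + Bnorm G v.
Proof.
move=> fu fv; have uvoo := finite_energyD fu fv.
have [[uL uoo] [vL voo]] := (fu, fv).
apply: root4_le_add => [|||s s0 s1]; try exact/fine_ge0/Bform_ge0.
by rewrite -lee_fin Bform_fin//; exact: energy_quartic.
Qed.

Lemma BformZ_sqr a u : finite_energy u ->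
  Bform G (fun x => (a * u x) ^+ 2) = (a ^+ 4 * fine (Bform G (fun x => u x ^+ 2)))%:E.
Proof.
move=> [uL uoo].
rewrite (_ : (fun x => (a * u x) ^+ 2) = (fun x => a ^+ 2 * u x ^+ 2)).
  rewrite (BformZ _ (measurable_funX 2 (L2_measurable uL)))// [RHS]EFinM Bform_fin//.
  by rewrite -exprM.
by apply/funext => x; rewrite exprMn.
Qed.

Lemma BnormZ a u : finite_energy u -> Bnorm G (fun x => a * u x) = `|a| * Bnorm G u.
Proof.
move=> fu; rewrite /Bnorm BformZ_sqr// [fine _%:E]/= powRM//.
- congr (_ * _); rewrite -[a ^+ 4]ger0_norm ?exprn_even_ge0//.
  rewrite normrX -powR_mulrn// -powRrM mulfV// powRr1//.
- by rewrite exprn_even_ge0.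
- exact/fine_ge0/Bform_ge0.
Qed.

End Energy.
(** * The energy space *)

Section EnergySpaceBanach.
Context {R : realType} (G : R -> R -> R).
Hypothesis G_meas : measurable_fun [set: R * R] (fun z : R * R => G z.1 z.2).
Hypothesis G_ge0 : forall x y, 0 <= G x y.
Hypothesis G_psd : pos_semidef G.
Implicit Types (u v : R -> R).
Local Notation leb := (@lebesgue_measure R).
Local Notation L2 := (Lfun leb 2%:E).

Let N u := H1norm u + Bnorm G u.

Lemma calB_finite_energy u : calB G u -> finite_energy G u.
Proof. by move=> [[uL _] uoo]. Qed.

Lemma calB_0 : calB G (fun=> 0).
Proof.
split; first exact: H1_0.
rewrite Bform_ae0// ?ltry//; exact: aeW.
Qed.

Lemma calB_lin a u v : calB G u -> calB G v -> calB G (fun x => a * u x + v x).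
Proof.
move=> Bu Bv; split; first by apply: H1_lin; [case: Bu|case: Bv].
have [fu fv] := (calB_finite_energy Bu, calB_finite_energy Bv).
apply: (finite_energyD G_meas G_ge0 G_psd (u := fun x => a * u x)) => //; split.
  rewrite (_ : (fun _ => _) = (fun x => a * u x + 0)).
    by apply: L2_lin L2_0; case: fu.
  by apply/funext => x; rewrite addr0.
by rewrite BformZ_sqr// ltry.
Qed.

Lemma calB_sub u v : calB G u -> calB G v -> calB G (u - v).
Proof.
rewrite (_ : u - v = (fun x => -1 * v x + u x)) => [Bu Bv|]; first exact: calB_lin.
by apply/funext => x; rewrite mulN1r addrC.
Qed.

Lemma calB_normD u v : calB G u -> calB G v -> N (u + v) <= N u + N v.
Proof.
move=> Bu Bv; have [fu fv] := (calB_finite_energy Bu, calB_finite_energy Bv).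
rewrite /N addrACA lerD// ?BnormD//.
by apply: H1normD; [case: Bu|case: Bv].
Qed.

Lemma calB_normZ a u : calB G u -> N (fun x => a * u x) = `|a| * N u.
Proof.
move=> Bu; have fu := calB_finite_energy Bu.
by rewrite /N mulrDr BnormZ// H1normZ//; case: Bu.
Qed.

Lemma calB_norm_eq0 u : calB G u -> N u = 0 <-> {ae leb, forall x, u x = 0}.
Proof.
move=> [[uL _] _]; split=> [N0|u0].
  apply: L2norm0_ae => //; apply/eqP; rewrite eq_le L2norm_ge0 andbT.
  rewrite (le_trans (L2norm_le_H1norm u))// -N0 lerDl; exact: powR_ge0.
rewrite /N H1norm_ae0// add0r /Bnorm Bform_ae0//; last exact: L2_measurable.
by rewrite powR0// invr_eq0.
Qed.

(** Letting m grow in the bound on f n - f m gives the energy bound for the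
    difference with the limit u. Membership of u follows afterwards, as u is
    f 0 minus a difference already known to lie in the space. *)
Lemma calB_complete (f : nat -> R -> R) : (forall n, calB G (f n)) ->
  (forall n m, (n <= m)%N -> N (f n - f m) <= 2^-1 ^+ n) ->
  exists u, calB G u /\ N (f n - u) @[n --> \oo] --> 0.
Proof.
move=> fB rapid.
have HN u : H1norm u <= N u by rewrite lerDl powR_ge0.
have BN u : Bnorm G u <= N u by rewrite lerDr H1norm_ge0.
have [n|n m nm|u [Hu fu fule]] := @H1_complete _ f.
- by have [] := fB n.
- exact: le_trans (HN _) (rapid n m nm).
have fm n : measurable_fun setT (f n) by apply: L2_measurable; have [[]] := fB n.
have um : measurable_fun setT u by apply: L2_measurable; case: Hu.
have Ble n : (Bform G (fun x => (f n x - u x) ^+ 2)%R <= ((2^-1 ^+ n) ^+ 4)%:E)%E.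
  apply: (Bform_lsc G_meas G_ge0 (f := fun m x => f n x - f (n + m)%N x)
    (u := fun x => f n x - u x)).
  - by move=> m; exact: measurable_funB.
  - exact: measurable_funB.
  - apply: filterS fu => x fx; apply: cvgB; first exact: cvg_cst.
    under eq_cvg do rewrite addnC.
    by have := fx; rewrite -(cvg_shiftn n (f^~ x)).
  - move=> m; have [_ Boo] := calB_sub (fB n) (fB (n + m)%N).
    have sq0 x : 0 <= (f n x - f (n + m)%N x) ^+ 2 by exact: sqr_ge0.
    rewrite -(Bform_fin G_ge0 sq0 Boo) lee_fin.
    rewrite -[leLHS](root4K (fine_ge0 (Bform_ge0 G_ge0 sq0))).
    rewrite lerXn2r ?nnegrE ?powR_ge0 ?exprn_ge0//.
    exact: le_trans (BN _) (rapid n (n + m)%N (leq_addr _ _)).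
have Boo n : (Bform G (fun x => (f n x - u x) ^+ 2)%R < +oo)%E.
  exact: le_lt_trans (Ble n) (ltry _).
have Bnle n : Bnorm G (f n - u) <= 2^-1 ^+ n.
  rewrite -(@ler_pXn2r _ 4)// ?nnegrE ?powR_ge0 ?exprn_ge0//.
  have sq0 x : 0 <= (f n x - u x) ^+ 2 by exact: sqr_ge0.
  rewrite root4K; last exact: fine_ge0 (Bform_ge0 G_ge0 sq0).
  by rewrite -lee_fin (Bform_fin G_ge0 sq0 (Boo n)).
have fuB n : calB G (f n - u).
  split; last exact: Boo.
  rewrite (_ : f n - u = (fun x => -1 * u x + f n x)).
    by apply: H1_lin => //; have [] := fB n.
  by apply/funext => x; rewrite mulN1r addrC.
exists u; split.
  by rewrite -[u](subKr (f 0%N)); exact: calB_sub.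
(* 2 from the two L^2 norms in the H^1 norm, 1 from the energy. *)
have c0 : 3 * 2^-1 ^+ n @[n --> \oo] --> (0 : R).
  rewrite -(mulr0 3); apply: cvgM; first exact: cvg_cst.
  by apply: cvg_expr; rewrite ger0_norm// invf_lt1// ltr1n.
apply: (squeeze_cvgr _ (cvg_cst 0) c0); apply: nearW => n.
rewrite addr_ge0 ?H1norm_ge0 ?powR_ge0//= (le_trans (lerD (fule n) (Bnle n)))//.
by rewrite le_eqVlt; apply/orP; left; apply/eqP; ring.
Qed.

(** The functions of the space as a vector space in their own right, on which
    the norm is an everywhere defined seminorm. *)
Definition calB_pred : {pred R -> R} := fun u => `[< calB G u >].

Let calB_submod : submod_closed calB_pred.
Proof.
split; first by apply/asboolP; exact: calB_0.
by move=> a u v /asboolP Bu /asboolP Bv; apply/asboolP; exact: calB_lin.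
Qed.

HB.instance Definition _ := GRing.isSubmodClosed.Build _ _ calB_pred calB_submod.

Record calB_type := CalB { calB_val : R -> R; calB_valP : calB_val \in calB_pred }.
HB.instance Definition _ := [isSub for calB_val].
HB.instance Definition _ := [Choice of calB_type by <:].
HB.instance Definition _ := [SubChoice_isSubLmodule of calB_type by <:].

Let valB (w : calB_type) : calB G (val w).
Proof. exact/asboolP/(valP w). Qed.

Lemma calB_banach : banach_mod_ae (calB G) N.
Proof.
split; [exact: calB_0|exact: calB_lin|].
pose NW (w : calB_type) := N (val w).
have ND x y : NW (x + y) <= NW x + NW y.
  by rewrite /NW raddfD; exact: calB_normD (valB x) (valB y).
have NZ a x : NW (a *: x) = `|a| * NW x.
  by rewrite /NW linearZ; exact: calB_normZ (valB x).
have NC (f : nat -> calB_type) :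
    (forall n m, (n <= m)%N -> NW (f n - f m) <= 2^-1 ^+ n) ->
    exists l, NW (f n - l) @[n --> \oo] --> 0.
  move=> rapid.
  have [n|n m nm|u [Bu cu]] := @calB_complete (fun n => val (f n)).
  - exact: valB.
  - by rewrite -raddfB; exact: rapid.
  have uP : u \in calB_pred by exact/asboolP.
  have e : (fun n => N (val (f n) - u)) = (fun n => NW (f n - CalB uP)).
    by apply/funext => n; rewrite /NW raddfB.
  by exists (CalB uP); rewrite -e.
have [V [cls [clsL clsE clsT clsN]]] := seminorm_quot_banach ND NZ NC.
exists V, (fun u => cls (insubd 0 u)).
have insubK u : calB G u -> val (insubd (0 : calB_type) u) = u.
  by move=> Bu; rewrite insubdK//; exact/asboolP.
split.
- move=> a u v Bu Bv; rewrite -clsL; congr cls; apply: val_inj.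
  rewrite insubK; last exact: calB_lin.
  rewrite linearP; apply: (congr2 (fun f g : R -> R => a *: f + g)); exact/esym/insubK.
- move=> u v Bu Bv; apply: (iff_trans (clsE _ _)).
  have -> : NW (insubd 0 u - insubd 0 v) = N (u - v).
    rewrite /NW raddfB; apply: (congr2 (fun f g : R -> R => N (f - g))); exact: insubK.
  apply: (iff_trans (calB_norm_eq0 (calB_sub Bu Bv))).
  split; apply: filterS => x.
    by rewrite -[_ x]/(u x - v x) => /eqP; rewrite subr_eq0 => /eqP.
  by rewrite -[(_ - _) x]/(u x - v x) => ->; rewrite subrr.
- apply/seteqP; split=> // q _; have : (cls @` setT) q by rewrite clsT.
  by move=> [w _ <-]; exists (val w); [exact: valB|rewrite valKd].
- by move=> u Bu; rewrite clsN /NW insubK.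
Qed.

End EnergySpaceBanach.

Theorem theorem3 (R : realType) (G : R -> R -> R)
  (G_meas : measurable_fun [set: R * R] (fun z : R * R => G z.1 z.2))
  (G_ge0 : forall x y : R, 0 <= G x y)
  (G_sym : forall x y : R, G x y = G y x)
  (G_psd : pos_semidef G) :
  banach_mod_ae (calB G) (fun u : R -> R => H1norm u + Bnorm G u).
Proof. exact: calB_banach. Qed.
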